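(* Let $\mu=1$, let $\nu\in\{0,1\}$, let $n\geq 2$ and $m,N\geq 1$ be integers, let $f:[-1,1]\to\mathbb R$ be an admissible potential function such that $f^{(2m+1+\nu)}\geq 0$ on $(-1,1)$, and let the weighted code $(C,W)=(x_1,\ldots,x_N;w_1,\ldots,w_N)\in\mathcal J_{n,N}$ be a $(2m+\nu)$-design. Let $\lambda_j$ and $\tau_j$, $j=1-\nu,\ldots,m+1$, be the nodes and weights of the quadrature (Q) of the context with $\mu=1$. Then $$U_f(x,C;W)=\sum_{i=1}^{N}w_if(x\cdot x_i)\leq \sum_{j=1-\nu}^{m+1}\tau_jf(\lambda_j),\qquad x\in \mathbb{S}^{n-1}.\qquad ( * )$$ If $(C,W)$ is a weakly sharp $(2m+\nu)$-design, then equality holds in $( * )$ at every point $x\in A_{1,\nu}$ forming $m+\nu$ distinct dot products with other points of $C$. If $f^{(2m+1+\nu)}>0$ on $(-1,1)$ and equality holds in $( * )$ at some point $x\in \mathbb{S}^{n-1}$, then (i) the point $x$ lies in $A_{1,\nu}$ and forms exactly $m+1+\nu$ distinct dot products, namely $\lambda_{1-\nu},\ldots,\lambda_{m+1}$, with points of the code $C$; (ii) the weighted code $(C,W)$ is a weakly sharp $(2m+\nu)$-design; and (iii) for every $j=1-\nu,\ldots,m+1$, the sum of the weights of the points of $C$ forming dot product $\lambda_j$ with $x$ is exactly $\tau_j$.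
   Context: $\mathbb S^{n-1}$ is the unit sphere in $\mathbb R^n$, $x\cdot y$ is the standard dot product, and $\mathbb P_k$ is the space of univariate real polynomials of degree at most $k$. $\mathcal J_{n,N}$ is the set of weighted codes $(C,W)=(x_1,\ldots,x_N;w_1,\ldots,w_N)$, where $C=\{x_1,\ldots,x_N\}$ consists of $N$ pairwise distinct points of $\mathbb S^{n-1}$ and $W=(w_1,\ldots,w_N)$ has strictly positive components with $w_1+\ldots+w_N=1$; $w_i$ is the weight of $x_i$. An admissible potential function is a function $f:[-1,1]\to(-\infty,\infty]$ that is finite and differentiable on $(-1,1)$ and satisfies $\lim_{t\to-1^+}f(t)=f(-1)$ and $\lim_{t\to1^-}f(t)=f(1)$ (here $f$ is real-valued on all of $[-1,1]$). A condition on $f^{(k)}$ on $(-1,1)$ includes the existence of that derivative there. The potential is $U_f(x,C;W):=\sum_{i=1}^N w_i f(x\cdot x_i)$. A weighted code $(C,W)\in\mathcal J_{n,N}$ is a (weighted spherical) $k$-design if for every $p\in\mathbb P_k$ the sum $\sum_{i=1}^N w_i p(x\cdot x_i)$ is constant in $x\in\mathbb S^{n-1}$ (the constant is then $\int_{-1}^1p(t)w_n(t)\,dt$), where $w_n(t)=\gamma_n(1-t^2)^{(n-3)/2}$ and $\gamma_n>0$ makes $w_n$ a probability density on $[-1,1]$. $(C,W)$ is a weakly sharp $2m$-design ($m\ge 1$) if it is a $2m$-design and $C$ contains a point $z$ forming at most $m$ distinct dot products with other points of $C$. $(C,W)$ is a weakly sharp $(2m+1)$-design ($m\ge0$) if it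 is a $(2m+1)$-design and $C$ contains a point $z$ forming at most $m+1$ distinct dot products with other points of $C$, one of which is $-1$. Sets: $A_{1,0}:=C$ and $A_{1,1}:=C\cap(-C)$. Quadrature (Q): for $\mu,\nu\in\{0,1\}$ let $P_m^{\mu,\nu}$ be the polynomial of degree $m$ orthogonal to $\mathbb P_{m-1}$ on $[-1,1]$ with weight $(1-t)^\mu(1+t)^\nu w_n(t)$, normalized by $P_m^{\mu,\nu}(1)=1$; its zeros are simple and lie in $(-1,1)$. Let $-1\le\lambda_{1-\nu}<\ldots<\lambda_{m+\mu}\le1$ be the zeros of $P_m^{\mu,\nu}(t)(1-t)^\mu(1+t)^\nu$ (so $\lambda_1,\ldots,\lambda_m$ are the zeros of $P_m^{\mu,\nu}$, $\lambda_0=-1$ if $\nu=1$, $\lambda_{m+1}=1$ if $\mu=1$), and let $\tau_{1-\nu},\ldots,\tau_{m+\mu}$ be the unique weights such that $$\int_{-1}^1p(t)w_n(t)\,dt=\sum_{k=1-\nu}^{m+\mu}\tau_kp(\lambda_k)\quad\text{for all }p\in\mathbb P_{2m-1+\mu+\nu}.$$ *)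

(* Defs.v *)
From HB Require Import structures.
From mathcomp Require Import all_boot all_order all_algebra.
From mathcomp Require Import all_classical all_reals all_analysis.
Import Order.TTheory GRing.Theory Num.Theory.
Import numFieldNormedType.Exports.

Set Implicit Arguments.
Unset Strict Implicit.
Unset Printing Implicit Defensive.

Local Open Scope classical_set_scope.
Local Open Scope ring_scope.

Section Defs.
Context {R : realType}.

Definition dotp (n : nat) (x y : 'rV[R]_n) : R := \sum_(i < n) x 0 i * y 0 i.

Definition sphere (n : nat) : set 'rV[R]_n := [set x | dotp x x = 1].

Definition weighted_code (n N : nat) (X : 'I_N -> 'rV[R]_n) (w : 'I_N -> R) :=
  [/\ injective X, (forall i, sphere (X i)), (forall i, 0 < w i)
    & \sum_(i < N) w i = 1].

(* A function on [-1, 1] is represented by a total function on R, of which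
   only the values on [-1, 1] are ever used. *)
Definition admissible (f : R -> R) :=
  [/\ (forall t : R, t \in `]-1, 1[ -> derivable f t 1),
      f t @[t --> (-1)^'+] --> f (-1)
    & f t @[t --> 1^'-] --> f 1].

(* f^(k) exists at every point of (-1, 1). *)
Definition has_deriv (k : nat) (f : R -> R) :=
  forall j, (j < k)%N -> forall t : R, t \in `]-1, 1[ -> derivable (derive1n j f) t 1.

Definition potential (n N : nat) (f : R -> R) (X : 'I_N -> 'rV[R]_n)
    (w : 'I_N -> R) (x : 'rV[R]_n) : R :=
  \sum_(i < N) w i * f (dotp x (X i)).

(* The condition size p <= k.+1 means that p has degree at most k. *)
Definition design (k n N : nat) (X : 'I_N -> 'rV[R]_n) (w : 'I_N -> R) :=
  forall p : {poly R}, (size p <= k.+1)%N ->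
    exists c : R, forall x, sphere x ->
      \sum_(i < N) w i * p.[dotp x (X i)] = c.

(* Distinct dot products, listed without repetition, formed by z with the
   points of the code, respectively with the points of the code other than z. *)
Definition dots (n N : nat) (X : 'I_N -> 'rV[R]_n) (z : 'rV[R]_n) : seq R :=
  undup [seq dotp z (X i) | i <- enum 'I_N].

Definition other_dots (n N : nat) (X : 'I_N -> 'rV[R]_n) (z : 'rV[R]_n) :
    seq R :=
  undup [seq dotp z (X i) | i <- enum 'I_N & X i != z].

Definition weakly_sharp_even (m n N : nat) (X : 'I_N -> 'rV[R]_n)
    (w : 'I_N -> R) :=
  design (2 * m) X w /\
  exists2 z, range X z & (size (other_dots X z) <= m)%N.

Definition weakly_sharp_odd (m n N : nat) (X : 'I_N -> 'rV[R]_n)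
    (w : 'I_N -> R) :=
  design (2 * m + 1) X w /\
  exists2 z, range X z &
    (size (other_dots X z) <= m + 1)%N /\ -1 \in other_dots X z.

(* Weakly sharp (2m + nu)-design. *)
Definition weakly_sharp (m : nat) (nu : bool) (n N : nat)
    (X : 'I_N -> 'rV[R]_n) (w : 'I_N -> R) :=
  if nu then weakly_sharp_odd m X w else weakly_sharp_even m X w.

(* The set A_{1, nu}: C if nu = 0, and the intersection of C and -C if nu = 1. *)
Definition A1 (nu : bool) (n N : nat) (X : 'I_N -> 'rV[R]_n) : set 'rV[R]_n :=
  if nu then range X `&` [set - y | y in range X] else range X.

(* The real power `^ vanishes at base 0 for a nonzero exponent, so when n = 2
   the integrable singularities at the endpoints get the harmless value 0. *)
Definition wn_raw (n : nat) (t : R) : R := (1 - t ^+ 2) `^ ((n%:R - 3) / 2).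

Definition gamma (n : nat) : R :=
  (\int[lebesgue_measure]_(t in `[-1, 1]) wn_raw n t)^-1.

Definition wn (n : nat) (t : R) : R := gamma n * wn_raw n t.

Definition orth_poly (n : nat) (mu nu : bool) (m : nat) (P : {poly R}) :=
  [/\ size P = m.+1,
      (forall q : {poly R}, (size q <= m)%N ->
         \int[lebesgue_measure]_(t in `[-1, 1])
            (P.[t] * q.[t] * ((1 - t) ^+ mu * (1 + t) ^+ nu * wn n t)) = 0)
    & P.[1] = 1].

(* The nodes lambda j and weights tau j are those with 1 - nu <= j <= m + mu;
   the values of lambda and tau at other indices are irrelevant. *)
Definition quadrature (n : nat) (mu nu : bool) (m : nat)
    (lambda tau : nat -> R) :=
  [/\ (forall i j, (1 - nu <= i)%N -> (i < j)%N -> (j <= m + mu)%N ->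
         lambda i < lambda j),
      (exists2 P : {poly R}, orth_poly n mu nu m P &
         forall t, P.[t] * (1 - t) ^+ mu * (1 + t) ^+ nu = 0 <->
           exists2 j, (1 - nu <= j <= m + mu)%N & lambda j = t)
    & (forall p : {poly R}, (size p <= 2 * m + mu + nu)%N ->
         \int[lebesgue_measure]_(t in `[-1, 1]) (p.[t] * wn n t) =
         \sum_(1 - nu <= j < (m + mu).+1) tau j * p.[lambda j])].

End Defs.

(* Main.v *)
Require Import Defs.
From HB Require Import structures.
From mathcomp Require Import all_boot all_order all_algebra.
From mathcomp Require Import all_classical all_reals all_analysis.
From mathcomp Require Import measurable_realfun ring lra zify.
Import Order.TTheory GRing.Theory Num.Theory.
Import numFieldNormedType.Exports.

(** Put K = 2m + nu. Let L be the polynomial of degree at most K that agrees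
    with f at every quadrature node, and whose derivative agrees with that of f
    at the nodes inside (-1, 1). These are K + 1 conditions, and the error is
      f(t) - L(t) = f^(K+1)(xi) / (K+1)! * (t - 1) (t + 1)^nu prod_j (t - lambda_j)^2
    ([hermite_error]), the product running over the nodes inside (-1, 1). The
    product is nonpositive on [-1, 1], so f <= L there, and when f^(K+1) > 0 the
    two functions agree only at the nodes ([hermite_majorant]). Both the design
    and the quadrature integrate L exactly, whence
      U_f(x) <= sum_i w_i L(x . x_i) = int L w_n = sum_j tau_j L(lambda_j)
              = sum_j tau_j f(lambda_j).
    Equality therefore holds as soon as all dot products of x with the code are
    nodes ([potential_eq_nodes]), and only then if f^(K+1) > 0
    ([potential_eq_dots]). What remains is to relate this condition to the
    geometry of the code.

    The middle equality identifies the constant of a design with an integral on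
    [-1, 1] ([design_integral]). It needs no surface measure: the averages
    c_k = sum_i w_i (x . x_i)^k and the normalized moments of w_n both start
    from 1, vanish for odd k, and satisfy (k + n) c_(k+2) = (k + 1) c_k. For
    the moments, integrate the derivative of t^(k+1) (1 - t^2)^((n-1)/2)
    ([moment_rec]). For the averages, with k + 2 even, compare the Laplacians of
    sum_i w_i (v . x_i)^(k+2) and c_(k+2) |v|^(k+2), which agree on all of R^n
    by homogeneity ([design_moment_rec]).

    A nonzero polynomial of degree at most K that is nonnegative on [-1, 1] has
    a positive average over the code ([design_gt0]), because the dot products
    with a single code point already fill [-1, 1] as x varies. Testing the
    quadrature on suitable polynomials of constant sign then places the nodes
    ([others_itv]) and shows that the weights tau_j are positive ([tau_gt0]).

    If all dot products of x are nodes, Lagrange polynomials show that the code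
    carries mass exactly tau_j > 0 at dot product lambda_j ([node_mass]). So
    every node occurs; as 1 is a node, x lies in C, and as -1 is a node when
    nu = 1, so does -x ([node_dots_structure]). Conversely, if x in A_(1,nu)
    forms m + nu dot products with other code points, then a node different from
    all of these would have weight zero, so a count shows that the dot products
    are exactly the nodes ([sharp_dots]). *)

Set Implicit Arguments.
Unset Strict Implicit.
Unset Printing Implicit Defensive.

Local Open Scope classical_set_scope.
Local Open Scope ring_scope.

(** * Monic polynomials with prescribed roots *)

Section RootPoly.
Context {R : realType}.
Implicit Types (s : seq R) (t : R).

Definition root_poly s : {poly R} := \prod_(x <- s) ('X - x%:P).

Lemma root_poly_monic s : root_poly s \is monic.
Proof. exact: monic_prod_XsubC. Qed.

Lemma root_poly_nil t : (root_poly [::]).[t] = 1 :> R.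
Proof. by rewrite /root_poly big_nil hornerC. Qed.

Lemma root_poly_cons a s t : (root_poly (a :: s)).[t] = (t - a) * (root_poly s).[t].
Proof. by rewrite /root_poly big_cons hornerM hornerXsubC. Qed.

Lemma root_poly_cat s1 s2 t :
  (root_poly (s1 ++ s2)).[t] = (root_poly s1).[t] * (root_poly s2).[t].
Proof. by rewrite /root_poly big_cat hornerM. Qed.

Lemma perm_root_poly s1 s2 : perm_eq s1 s2 -> root_poly s1 = root_poly s2.
Proof. exact: perm_big. Qed.

Lemma root_poly_eq0 s t : ((root_poly s).[t] == 0) = (t \in s).
Proof. by rewrite -rootE root_prod_XsubC. Qed.

Lemma root_poly_mem s t : t \in s -> (root_poly s).[t] = 0.
Proof. by rewrite -root_poly_eq0 => /eqP. Qed.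

Lemma size_root_poly s : size (root_poly s) = (size s).+1.
Proof. exact: size_prod_XsubC. Qed.

Lemma root_poly_neq0 s : root_poly s != 0.
Proof. exact/monic_neq0/root_poly_monic. Qed.

Lemma size_root_polyM s1 s2 :
  size (root_poly s1 * root_poly s2) = (size s1 + size s2).+1.
Proof. by rewrite -[_ * _]big_cat size_root_poly size_cat. Qed.

End RootPoly.

(** * Rolle's theorem and Hermite interpolation *)

Section Interpolation.
Context {R : realType}.
Implicit Types (f g phi : R -> R) (p : {poly R}) (s z : seq R).

(** Applying Rolle's theorem between consecutive zeros produces points that
    avoid the zeros themselves. This keeps them apart from double zeros of
    [phi], which are zeros of the derivative as well. *)
Lemma rolle_path (phi : R -> R) (a : R) (s : seq R) :
  path <%R a s -> {within `[a, last a s], continuous phi} ->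
  (forall x, x \in `]a, last a s[ -> derivable phi x 1) ->
  {in a :: s, forall x, phi x = 0} ->
  exists s', [/\ size s' = size s, path <%R a s',
    {in s', forall x, [/\ x \in `]a, last a s[, x \notin a :: s & derive1 phi x = 0]}
    & uniq s'].
Proof.
elim: s a => [|b s IHs] a /=; first by exists [::].
move=> /andP[ab pbs] cphi dphi phi0.
have bl : b <= last b s.
  have := mem_last b s; rewrite inE => /predU1P[->//|].
  by move=> /(allP (order_path_min lt_trans pbs))/ltW.
have [|||s' [ss' ps' s'P us']] := IHs b pbs.
- apply: continuous_subspaceW cphi; apply: subset_itvr.
  by rewrite bnd_simp ltW.
- by move=> x; rewrite in_itv/= => /andP[bx xl]; apply: dphi; rewrite in_itv/= (lt_trans ab).
- by move=> x xs; apply: phi0; rewrite inE xs orbT.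
have [|||c cab c0] := @Rolle R phi a b ab.
- move=> x; rewrite in_itv/= => /andP[ax xb]; apply: dphi.
  by rewrite in_itv/= ax (lt_le_trans xb).
- by apply: continuous_subspaceW cphi; apply: subset_itvl; rewrite bnd_simp.
- by rewrite !phi0 ?inE ?eqxx ?orbT.
have /andP[ac cb] : a < c < b by move: cab; rewrite in_itv.
have bs' x : x \in s' -> b < x := allP (order_path_min lt_trans ps') x.
exists (c :: s'); split => /=.
- by rewrite ss'.
- by rewrite ac; case: (s') ps' => //= y t /andP[yb ->]; rewrite (lt_trans cb).
- move=> x; rewrite inE => /predU1P[->|xs'].
    split; first by rewrite in_itv/= ac (lt_le_trans cb).
      rewrite !inE (gt_eqF ac) (lt_eqF cb)/=; apply/negP.
      by move/(allP (order_path_min lt_trans pbs)); rewrite ltNge (ltW cb).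
    by rewrite derive1E; exact: derive_val.
  have [xI xn x0] := s'P x xs'; split => //.
    by move: xI; rewrite !in_itv/= => /andP[bx ->]; rewrite (lt_trans ab).
  by rewrite inE (gt_eqF (lt_trans ab (bs' x xs'))).
- by rewrite us' andbT; apply/negP => /bs'; rewrite ltNge (ltW cb).
Qed.

(** The endpoints may be included or not: at the first step the zeros lie in
    [-1, 1] and [phi] is only continuous at the ends, while later derivatives
    are controlled on the open interval only. *)
Lemma rolle_zeros (phi : R -> R) (a b : R) (ca cb : bool) (s : seq R) :
  {within [set` Interval (BSide ca a) (BSide cb b)], continuous phi} ->
  (forall x, x \in `]a, b[ -> derivable phi x 1) ->
  uniq s ->
  {in s, forall x, x \in Interval (BSide ca a) (BSide cb b) /\ phi x = 0} ->
  exists s', [/\ size s' = (size s).-1, uniq s' &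
    {in s', forall x, [/\ x \in `]a, b[, x \notin s & derive1 phi x = 0]}].
Proof.
move=> cphi dphi us s0.
have sE := mem_sort <=%R s.
have ss : sorted <%R (sort <=%R s) by rewrite sort_lt_sorted.
have szs : size (sort <=%R s) = size s by rewrite size_sort.
case: (sort <=%R s) ss szs sE => [|c t] /= pct <- sE; first by exists [::].
have /s0[cI _] : c \in s by rewrite -sE mem_head.
have /s0[lI _] : last c t \in s by rewrite -sE mem_last.
have /andP[ac _] : a <= c <= b.
  by move: cI; rewrite in_itv/=; case: ca cb {s0 cphi lI} => -[] /andP[] /lteifW-> /lteifW->.
have /andP[_ lb] : a <= last c t <= b.
  by move: lI; rewrite in_itv/=; case: ca cb {s0 cphi cI} => -[] /andP[] /lteifW-> /lteifW->.
have [|||s' [ss' _ s'P us']] := @rolle_path phi c t pct.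
- apply: continuous_subspaceW cphi => x /=.
  move: cI lI; rewrite !itv_boundlr => /andP[aci _] /andP[_ lbi] /andP[cx xl].
  by rewrite (le_trans aci)//= (le_trans _ lbi).
- move=> x; rewrite in_itv/= => /andP[cx xl]; apply: dphi.
  by rewrite in_itv/= (le_lt_trans ac)// (lt_le_trans xl).
- by move=> x; rewrite sE => /s0[].
exists s'; split => // x /s'P[]; rewrite !in_itv/= => /andP[cx xl] xs x0; split => //.
  by rewrite (le_lt_trans ac)// (lt_le_trans xl).
by rewrite -sE.
Qed.

Lemma iterated_rolle (n : nat) phi s :
  has_deriv n phi -> uniq s -> size s = n.+1 ->
  {in s, forall x, (x \in `]-1, 1[) /\ phi x = 0} ->
  exists2 xi : R, xi \in `]-1, 1[ & derive1n n phi xi = 0.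
Proof.
elim: n phi s => [|n IHn] phi s dphi us ss s0.
  by case: s s0 ss {us} => // x s /(_ x (mem_head _ _))[]; exists x.
have d0 x : x \in `]-1, 1[ -> derivable phi x 1 by exact: (dphi 0).
have [||s' [ss' us' s'P]] := @rolle_zeros phi (-1) 1 false true s _ d0 us => //.
  exact: derivable_within_continuous.
have [|||xi xiI xi0] := IHn (derive1 phi) s' _ us'.
- by move=> j jn t tI; have := dphi j.+1 jn t tI; rewrite /derive1n iterSr.
- by rewrite ss' ss.
- by move=> x /s'P[].
by exists xi => //; rewrite /derive1n iterSr.
Qed.

(** The points [z] are double zeros of [phi]. One application of Rolle's theorem
    to all the zeros [s], together with [z], yields [size s + size z - 1]
    distinct zeros of the derivative inside (-1, 1). *)
Lemma rolle_double_zeros (n : nat) phi s z :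
  has_deriv n.+1 phi -> {within `[-1, 1], continuous phi} ->
  uniq s -> {in s, forall x, x \in `[-1, 1] /\ phi x = 0} ->
  uniq z -> {subset z <= s} ->
  {in z, forall x, (x \in `]-1, 1[) /\ derive1 phi x = 0} ->
  (size s + size z)%N = n.+2 ->
  exists2 xi : R, xi \in `]-1, 1[ & derive1n n.+1 phi xi = 0.
Proof.
move=> dphi cphi us s0 uz zs z0 szn.
have d0 x : x \in `]-1, 1[ -> derivable phi x 1 by exact: (dphi 0).
have [|s' [ss' us' s'P]] := @rolle_zeros phi (-1) 1 true false s cphi d0 us => //.
have s_gt0 : (0 < size s)%N.
  have := uniq_leq_size uz zs; case: (size s) szn => // + /[!leqn0] /eqP z0'.
  by rewrite z0'.
have [||||xi xiI xi0] := @iterated_rolle n (derive1 phi) (s' ++ z).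
- by move=> j jn t tI; have := dphi j.+1 jn t tI; rewrite /derive1n iterSr.
- rewrite cat_uniq us' uz andbT; apply/hasPn => x /zs xs.
  by apply: contraL xs => /s'P[].
- by rewrite size_cat ss' -[RHS]/(n.+2.-1) -szn; case: (size s) s_gt0.
- by move=> x; rewrite mem_cat => /orP[/s'P[]|/z0].
by exists xi => //; rewrite /derive1n iterSr.
Qed.

Lemma has_derivB n f (p : {poly R}) : has_deriv n f ->
  has_deriv n (fun x => f x - p.[x]) /\
  forall j, (j <= n)%N -> forall t, t \in `]-1, 1[ ->
    derive1n j (fun x => f x - p.[x]) t = derive1n j f t - (p^`(j)%R).[t].
Proof.
move=> df; set phi := fun x => _.
have E j : (j <= n)%N -> forall t, t \in `]-1, 1[ ->
    derive1n j phi t = derive1n j f t - (p^`(j)%R).[t].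
  elim: j => [|j IHj] jn t tI; first by rewrite derivn0.
  rewrite !derive1nS !derive1E derivnS.
  rewrite (near_eq_derive (g := (derive1n j f - horner (p^`(j)%R)))); last first.
    by near=> x; rewrite IHj ?(ltnW jn)//; near: x; exact: near_in_itvoo.
  rewrite deriveB; [|exact: df|exact: derivable_horner].
  by rewrite derivE derive1E.
split => // j jn t tI.
apply: (near_eq_derivable (f := (derive1n j f - horner (p^`(j)%R)))); last first.
  by apply: derivableB; [exact: df|exact: derivable_horner].
by near=> x; rewrite E ?(ltnW jn)//; near: x; exact: near_in_itvoo.
Unshelve. all: by end_near. Qed.

Lemma interpolation s (c : R -> R) : uniq s ->
  exists2 p : {poly R}, (size p <= size s)%N & {in s, forall x, p.[x] = c x}.
Proof.
elim: s => [|a s IHs] /=; first by exists 0; rewrite ?size_poly0.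
move=> /andP[as_ /IHs[p ps pc]].
have w0 : (root_poly s).[a] != 0 by rewrite root_poly_eq0.
exists (p + ((c a - p.[a]) / (root_poly s).[a]) *: root_poly s).
  rewrite (leq_trans (size_polyD _ _))// geq_max (leq_trans ps)//=.
  by rewrite (leq_trans (size_scale_leq _ _))// size_prod_XsubC.
move=> x; rewrite inE => /predU1P[->|xs]; rewrite hornerD hornerZ.
  by rewrite divfK// addrC subrK.
by rewrite [X in _ * X]root_poly_mem// mulr0 addr0 pc.
Qed.

Lemma deriv_root_poly_neq0 s x : uniq s -> x \in s -> ((root_poly s)^`()%R).[x] != 0.
Proof.
move=> us xs; rewrite /root_poly (big_rem x)//= derivM hornerD !hornerM.
rewrite derivXsubC !hornerE subrr mul0r addr0 -rootE.
by rewrite root_prod_XsubC mem_rem_uniq// inE eqxx.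
Qed.

(** Correct an interpolant [l] of the values by a multiple [W * q] of the
    polynomial with roots [s]: the values do not change, and since [W] has
    simple roots the derivatives at [z] can be adjusted by the choice of the
    values of [q] there. *)
Lemma hermite_interpolation s z (c d : R -> R) : uniq s -> uniq z -> {subset z <= s} ->
  exists L : {poly R}, [/\ (size L <= size s + size z)%N,
    {in s, forall x, L.[x] = c x} & {in z, forall x, (L^`()%R).[x] = d x}].
Proof.
move=> us uz zs; have [l ls lc] := @interpolation s c us.
set W := root_poly s.
have [q qz qc] := @interpolation z (fun x => (d x - (l^`()%R).[x]) / (W^`()%R).[x]) uz.
exists (l + W * q); split.
- rewrite (leq_trans (size_polyD _ _))// geq_max (leq_trans ls) ?leq_addr//=.
  rewrite (leq_trans (size_polyMleq _ _))// size_prod_XsubC.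
  by rewrite addSn leq_add2l.
- move=> x xs; rewrite hornerD hornerM.
  have /eqP-> : root W x by rewrite root_prod_XsubC.
  by rewrite mul0r addr0 lc.
- move=> x xz; rewrite derivD derivM hornerD hornerD !hornerM.
  have /eqP-> : root W x by rewrite root_prod_XsubC zs.
  rewrite mul0r addr0 qc// mulrC divfK ?deriv_root_poly_neq0 ?zs//.
  by rewrite addrC subrK.
Qed.

Lemma derivn_monic n p : p \is monic -> size p = n.+1 -> p^`(n)%R = n`!%:R%:P.
Proof.
move=> pm sp; apply/polyP => i; rewrite coef_derivn coefC.
case: i => [|i] /=; last by rewrite nth_default ?mul0rn// sp addnS ltnS leq_addr.
rewrite addn0 ffactnn; suff -> : p`_n = 1 by [].
by move/monicP: pm; rewrite lead_coefE sp.
Qed.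

(** The usual argument: subtract from [f - L] the multiple of [W] that creates an
    additional zero at [t]. The resulting function has [n + 2] zeros counted
    with multiplicity, so its derivative of order [n + 1] vanishes somewhere. *)
Lemma hermite_error n f s z (L : {poly R}) t :
  has_deriv n.+1 f -> {within `[-1, 1], continuous f} ->
  uniq s -> {in s, forall x, x \in `[-1, 1]} ->
  uniq z -> {subset z <= s} -> {in z, forall x, x \in `]-1, 1[} ->
  (size s + size z)%N = n.+1 ->
  (size L <= n.+1)%N -> {in s, forall x, L.[x] = f x} ->
  {in z, forall x, (L^`()%R).[x] = derive1 f x} ->
  t \in `[-1, 1] -> t \notin s ->
  exists2 xi : R, xi \in `]-1, 1[ &
    f t - L.[t] = derive1n n.+1 f xi / n.+1`!%:R * (root_poly s * root_poly z).[t].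
Proof.
move=> df cf us sI uz zs zI szn sL Ls Lz tI ts.
set W := root_poly s * root_poly z.
have Wt : W.[t] != 0.
  rewrite -rootE rootM !root_prod_XsubC negb_or ts/=.
  by apply: contra ts => /zs.
have sW : size W = n.+2.
  rewrite size_Mmonic ?monic_neq0 ?root_poly_monic//.
  by rewrite !size_prod_XsubC -szn addSn addnS.
have mW : W \is monic by rewrite monicMl root_poly_monic.
pose k := (f t - L.[t]) / W.[t]; pose p := L + k *: W.
have [dphi phiE] := @has_derivB n.+1 f p df.
have [|||||||xi xiI xi0] := @rolle_double_zeros n (fun x => f x - p.[x]) (t :: s) z dphi.
- move=> x; apply: cvgB; first exact: cf.
  by apply: continuous_subspaceT => y; exact: continuous_horner.
- by rewrite /= ts.
- move=> x; rewrite inE => /predU1P[->|xs]; split => //.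
  + by rewrite hornerD hornerZ divfK// opprD addrA subrr.
  + exact: sI.
  + have /eqP W0 : root W x by rewrite rootM root_prod_XsubC xs.
    by rewrite hornerD hornerZ W0 mulr0 addr0 Ls// subrr.
- by [].
- by move=> x /zs xs; rewrite inE xs orbT.
- move=> x xz; split; first exact: zI.
  have := phiE 1%N isT x (zI x xz); rewrite !derive1n1 derivn1 => ->.
  rewrite derivD derivZ derivM hornerD hornerZ hornerD !hornerM.
  have /eqP-> : root (root_poly s) x by rewrite root_prod_XsubC zs.
  have /eqP-> : root (root_poly z) x by rewrite root_prod_XsubC.
  by rewrite mulr0 mul0r !addr0 mulr0 addr0 Lz// subrr.
- by rewrite -szn.
exists xi => //; move: xi0; rewrite phiE// => /eqP; rewrite subr_eq0 => /eqP ->.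
rewrite derivnD derivnZ (derivn_monic mW sW) hornerD hornerZ hornerC.
rewrite [L^`(_)%R]derivn_poly0// horner0 add0r mulfK ?pnatr_eq0 -?lt0n ?fact_gt0//.
by rewrite divfK.
Qed.

End Interpolation.

(** * Moments of the weight *)

Section Moments.
Context {R : realType}.
Notation mu := (@lebesgue_measure R).
Implicit Types (f F : R -> R) (a b : R).

Lemma primitive_exists f a b : a < b ->
  mu.-integrable `[a, b] (EFin \o f) ->
  (forall x, x \in `]a, b[ -> {for x, continuous f}) ->
  exists G : R -> R, [/\ G a = 0, G b = \int[mu]_(t in `[a, b]) f t,
    {within `[a, b], continuous G} &
    forall x, x \in `]a, b[ -> is_derive x 1 G (f x)].
Proof.
move=> ab intf cf; exists (fun x => parameterized_integral mu a x f); split => //.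
- by rewrite /parameterized_integral set_itv1 Rintegral_set1.
- exact: parameterized_integral_continuous (ltW ab) intf.
- move=> x xab; have /andP[ax xb] : a < x < b by move: xab; rewrite in_itv.
  have [dG GE] := @continuous_FTC1_closed R f a x b xb intf ax (cf x xab).
  by split; [exact: dG|rewrite -derive1E; exact: GE].
Qed.

(** The integrand may be unbounded at the ends of the interval, as happens for
    the weight in dimension 2. Integrability makes its indefinite integral
    continuous up to the ends, and this indefinite integral differs from [F] by
    a constant. *)
Lemma Rintegral_FTC_oo f F a b : a < b ->
  mu.-integrable `[a, b] (EFin \o f) ->
  (forall x, x \in `]a, b[ -> {for x, continuous f}) ->
  {within `[a, b], continuous F} ->
  (forall x, x \in `]a, b[ -> is_derive x 1 F (f x)) ->
  \int[mu]_(t in `[a, b]) f t = F b - F a.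
Proof.
move=> ab intf cf cF dF.
have [G [Ga Gb cG dG]] := primitive_exists ab intf cf.
have [||c _ /eqP] := @MVT R (G - F) (fun=> 0) a b ab.
- by move=> x xab; have := is_deriveB (dG x xab) (dF x xab); rewrite subrr.
- by move=> x; apply: cvgB; [exact: cG|exact: cF].
rewrite mul0r !fctE Ga Gb sub0r opprK => /eqP; lra.
Qed.

Lemma Rintegral_gt0_oo f a b : a < b ->
  mu.-integrable `[a, b] (EFin \o f) ->
  (forall x, x \in `]a, b[ -> {for x, continuous f}) ->
  (forall x, x \in `]a, b[ -> 0 < f x) ->
  0 < \int[mu]_(t in `[a, b]) f t.
Proof.
move=> ab intf cf f0.
have [G [Ga Gb cG dG]] := primitive_exists ab intf cf.
have [c cab] := @MVT R G f a b ab dG cG.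
by rewrite Ga Gb subr0 => ->; rewrite mulr_gt0 ?f0// subr_gt0.
Qed.

Definition semicircle (t : R) : R := Num.sqrt (1 - t ^+ 2).

Lemma subr_sqr_gt0 (t : R) : t \in `]-1, 1[ -> 0 < 1 - t ^+ 2.
Proof. by rewrite in_itv/= => /andP[? ?]; nra. Qed.

Lemma semicircle_gt0 (t : R) : t \in `]-1, 1[ -> 0 < semicircle t.
Proof. by move=> tI; rewrite sqrtr_gt0 subr_sqr_gt0. Qed.

Lemma sqr_semicircle (t : R) : t \in `]-1, 1[ -> semicircle t ^+ 2 = 1 - t ^+ 2.
Proof. by move=> tI; rewrite sqr_sqrtr// ltW ?subr_sqr_gt0. Qed.

Lemma continuous_semicircle : continuous semicircle.
Proof.
move=> x; apply: continuous_comp; last exact: sqrt_continuous.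
by apply: cvgB; [exact: cvg_cst|exact: exprn_continuous].
Qed.

Lemma is_derive_semicircle (t : R) : t \in `]-1, 1[ ->
  is_derive t 1 semicircle (- t / semicircle t).
Proof.
move=> tI; have s0 := subr_sqr_gt0 tI.
have ds := is_derive1_sqrt s0.
have dq : is_derive t 1 (fun t : R => 1 - t ^+ 2) (- (2 * t)).
  by apply: is_derive_eq; rewrite /GRing.scale/=; ring.
have := @is_derive1_comp R (@Num.sqrt R) (fun t : R => 1 - t ^+ 2) t _ _ ds dq.
move=> /is_derive_eq; apply.
have := semicircle_gt0 tI; rewrite /semicircle => c0.
by rewrite invfM; field; rewrite gt_eqF.
Qed.

(** Half-integer powers of [1 - t^2] become integer powers of its square root,
    whose derivative is simpler. The dimension is at least 2, hence the form
    [n.+2]; dividing by [semicircle t] gives the exponent [n - 1], which is -1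
    in dimension 2. *)
Lemma wn_raw_semicircle n (t : R) : t \in `]-1, 1[ ->
  wn_raw n.+2 t = semicircle t ^+ n / semicircle t.
Proof.
move=> tI; have s0 := subr_sqr_gt0 tI.
have c0 := semicircle_gt0 tI.
rewrite /wn_raw (_ : (n.+2%:R - 3) / 2 = 2^-1 * n%:R - 2^-1); last first.
  by rewrite -addn2 natrD; field.
rewrite powRB; last by rewrite (gt_eqF s0) implybT.
rewrite powRrM powR12_sqrt ?(ltW s0)//.
by rewrite powR_mulrn// ltW.
Qed.

Lemma measurable_wn_raw n (D : set R) : measurable_fun D (@wn_raw R n).
Proof.
apply/measurable_funTS; apply: (measurableT_comp (measurable_powR _)).
by apply: measurable_funB => //; exact: measurable_funX.
Qed.

Lemma continuous_semicircleX n : continuous (fun t => semicircle t ^+ n).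
Proof.
move=> t; apply: (cvg_comp semicircle (fun x => x ^+ n)).
  exact: continuous_semicircle.
exact: exprn_continuous.
Qed.

Lemma continuous_wn_raw n (t : R) : t \in `]-1, 1[ -> {for t, continuous (@wn_raw R n.+2)}.
Proof.
move=> tI.
suff : {for t, continuous (fun t => semicircle t ^+ n / semicircle t)}.
  rewrite /prop_for/= /continuous_at wn_raw_semicircle// => h.
  apply: cvg_trans h; apply: near_eq_cvg.
  by near=> x; rewrite wn_raw_semicircle//; near: x; exact: near_in_itvoo.
apply: cvgM; first exact: continuous_semicircleX.
by apply: cvgV; [rewrite gt_eqF// semicircle_gt0|exact: continuous_semicircle].
Unshelve. all: by end_near. Qed.

(** In dimension 2 the weight is the derivative of the arcsine, so its integrals
    over compact subintervals of (-1, 1) are bounded by pi, and monotone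
    convergence applies. *)
Lemma integrable_wn_raw2 : mu.-integrable `[-1, 1] (EFin \o @wn_raw R 2).
Proof.
apply/integrableP; split; first by apply/measurable_EFinP; exact: measurable_wn_raw.
pose c i : R := 1 - i.+2%:R^-1.
have c01 i : 0 < c i < 1.
  by rewrite /c subr_gt0 gtrBl invr_gt0 ltr0n andbT invf_lt1// ltr1n.
pose E i := `[- c i, c i]%classic.
have EI i t : E i t -> t \in `]-1, 1[.
  have /andP[c0 c1] := c01 i.
  by rewrite /E/= !in_itv/= => /andP[? ?]; apply/andP; split; lra.
under eq_integral => t _ do rewrite /= ger0_norm ?powR_ge0//.
have gE : \bigcup_i E i = `]-1, 1[%classic.
  apply/seteqP; split => [t [i _ /EI]//|t /=].
  rewrite in_itv/= -ltr_norml -subr_gt0 => t1.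
  have [i _ /(_ i (leqnn i))/= it] := near_infty_natSinv_lt (PosNum t1).
  exists i => //; rewrite /E/= in_itv/= -ler_norml /c lerBrDl -lerBrDr.
  by rewrite (le_trans _ (ltW it))// lef_pV2 ?posrE// ler_nat.
have mf : measurable_fun (`]-1, 1[%classic : set R) (EFin \o @wn_raw R 2).
  by apply/measurable_EFinP; exact: measurable_wn_raw.
rewrite (integral_itv_bndoo (f := EFin \o @wn_raw R 2))// -gE.
have cvgE : (\int[mu]_(x in E i) (EFin \o @wn_raw R 2) x)%E @[i --> \oo] -->
    (\int[mu]_(x in \bigcup_i E i) (EFin \o @wn_raw R 2) x)%E.
  apply: ge0_nondecreasing_set_cvg_integral => //.
  - apply/nondecreasing_seqP => i; apply/subsetPset/subset_itv; rewrite bnd_simp.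
      by rewrite lerN2 /c lerB// lef_pV2 ?posrE// ler_nat.
    by rewrite /c lerB// lef_pV2 ?posrE// ler_nat.
  - by move=> i; exact: measurable_itv.
  - by move=> i; apply/measurable_EFinP; exact: measurable_wn_raw.
  - by move=> i t _; rewrite lee_fin powR_ge0.
rewrite -(cvg_lim _ cvgE)//.
apply: (@le_lt_trans _ _ (pi%:E)); last exact: ltry.
apply: lime_le; first by apply/cvg_ex; eexists; exact: cvgE.
apply: nearW => i.
have /andP[c0 c1] := c01 i.
have asinI (t : R) : t \in `]-1, 1[ -> is_derive t 1 (@asin R) (wn_raw 2 t).
  move=> tI; rewrite wn_raw_semicircle// expr0 mul1r.
  by apply: is_derive1_asin; move: tI; rewrite in_itv.
rewrite (@continuous_FTC2 _ _ (@asin R)).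
- rewrite -EFinB lee_fin.
  have := @asin_lepi2 R (c i); have := @asin_geNpi2 R (- c i).
  have -> : -1 <= c i <= 1 by apply/andP; split; lra.
  have -> : -1 <= - c i <= 1 by apply/andP; split; lra.
  by move=> /(_ isT) ? /(_ isT) ?; lra.
- lra.
- by apply: continuous_in_subspaceT => t /set_mem/EI; exact: continuous_wn_raw.
- have dc (x : R) : x \in `]-1, 1[ -> {for x, continuous (@asin R)}.
    by rewrite in_itv/=; exact: continuous_asin.
  split.
  + move=> t /subset_itv_oo_cc/EI tI; have := asinI t tI; exact: @ex_derive.
  + apply: cvg_at_right_filter; apply: dc; rewrite in_itv/=; apply/andP; split; lra.
  + apply: cvg_at_left_filter; apply: dc; rewrite in_itv/=; apply/andP; split; lra.
- move=> t /subset_itv_oo_cc/EI tI; rewrite derive1E.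
  by have := asinI t tI => -[_ ->].
Qed.

(** On (-1, 1) every weight is at most the one of dimension 2, because the
    exponent is smallest there. The summand 1 in the dominating function takes
    care of the endpoints, where the weight is 1 in dimension 3. *)
Lemma integrable_moment n k :
  mu.-integrable `[-1, 1] (EFin \o (fun t : R => t ^+ k * wn_raw n.+2 t)).
Proof.
have i1 : mu.-integrable `[-1, 1] (EFin \o (fun t : R => wn_raw 2 t + 1)).
  apply: (@integrableD _ _ _ mu _ _ (EFin \o wn_raw 2) (EFin \o cst 1)) => //=.
    exact: integrable_wn_raw2.
  apply: continuous_compact_integrable; first exact: segment_compact.
  by move=> x; exact: cvg_cst.
apply: le_integrable i1 => //=.
  apply/measurable_EFinP/measurable_funM; first exact: measurable_funX.
  exact: measurable_wn_raw.
move=> t; rewrite in_itv/= => /andP[t1 t2]; rewrite lee_fin.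
rewrite normrM normrX -[leRHS]mul1r ler_pM ?exprn_ge0//.
  by rewrite exprn_ile1// ler_norml t1.
have c0 : 0 <= wn_raw 2 t by exact: powR_ge0.
rewrite !ger0_norm ?powR_ge0 ?addr_ge0//.
have [tI|] := boolP (t \in `]-1, 1[).
  rewrite !wn_raw_semicircle// expr0 ler_wpDr// ler_wpM2r ?invr_ge0 ?sqrtr_ge0//.
  rewrite exprn_ile1 ?sqrtr_ge0// -(expr_le1 (n := 2)) ?sqrtr_ge0//.
  by rewrite sqr_semicircle// lerBlDr lerDl sqr_ge0.
rewrite in_itv/= negb_and -!leNgt => t0.
rewrite ler_wpDl// /wn_raw (_ : 1 - t ^+ 2 = 0); last first.
  by case/orP: t0 => t0; [have -> : t = -1 by lra|have -> : t = 1 by lra]; ring.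
by rewrite /powR eqxx; case: eqP.
Qed.

Definition moment n k : R := \int[mu]_(t in `[-1, 1]) (t ^+ k * wn_raw n t).

Lemma moment0_gt0 n : 0 < moment n.+2 0.
Proof.
apply: Rintegral_gt0_oo => //.
- exact: integrable_moment.
- by move=> t tI; apply: cvgM; [exact: exprn_continuous|exact: continuous_wn_raw].
- by move=> t tI; rewrite mul1r powR_gt0// subr_sqr_gt0.
Qed.

(** Integrate the derivative of [t^k * (1 - t^2)^((n+1)/2)], which vanishes at
    both ends. For [k = 0] this says that the first moment is zero. *)
Lemma moment_rec n k : k%:R * moment n.+2 k.-1 = (k + n.+1)%:R * moment n.+2 k.+1.
Proof.
have N11 : (-1 : R) < 1 by lra.
pose F (t : R) := t ^+ k * semicircle t ^+ n.+1.
pose f (t : R) := k%:R * (t ^+ k.-1 * wn_raw n.+2 t)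
  - (k + n.+1)%:R * (t ^+ k.+1 * wn_raw n.+2 t).
have iM j c : mu.-integrable `[-1, 1]
    (EFin \o (fun t : R => c * (t ^+ j * wn_raw n.+2 t))).
  exact: (integrableZl (mu := mu) _ c (integrable_moment n j)).
apply/eqP; rewrite -subr_eq0 /moment -!RintegralZl//; try exact: integrable_moment.
rewrite -RintegralB//.
apply/eqP; transitivity (F 1 - F (-1)); last first.
  by rewrite /F /semicircle sqrrN !expr1n subrr sqrtr0 !expr0n/= !mulr0 subr0.
apply: (@Rintegral_FTC_oo f F) => //.
- exact: (integrableB _ (iM k.-1 k%:R) (iM k.+1 (k + n.+1)%:R)).
- move=> t tI; apply: cvgB; (apply: cvgM; first exact: cvg_cst);
    (apply: cvgM; [exact: exprn_continuous|exact: continuous_wn_raw]).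
- apply: continuous_subspaceT => t; apply: cvgM; first exact: exprn_continuous.
  exact: continuous_semicircleX.
- move=> t tI; have dc := is_derive_semicircle tI.
  have c0 := semicircle_gt0 tI.
  have FE : F = (id ^+ k) * (semicircle ^+ n.+1).
    by apply/funext => x; rewrite !fctE.
  rewrite FE; apply: is_derive_eq.
  rewrite /f wn_raw_semicircle//=.
  have := sqr_semicircle tI.
  rewrite /GRing.scale/= !exprfctE; set c := semicircle t in c0 *.
  move=> c2; have -> : c ^+ n.+1 = c ^+ n / c * (1 - t ^+ 2).
    by rewrite -c2 exprS; field; rewrite gt_eqF.
  rewrite natrD; case: {F f FE} k => [|k] /=; rewrite ?exprS; field; exact: lt0r_neq0.
Qed.
End Moments.

(** * The unit sphere *)

Section Sphere.
Context {R : realType} {n : nat}.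
Implicit Types (x y u v : 'rV[R]_n) (a : R).

Lemma dotpC x y : dotp x y = dotp y x.
Proof. by apply: eq_bigr => i _; rewrite mulrC. Qed.

Lemma dotpDl x y u : dotp (x + y) u = dotp x u + dotp y u.
Proof. by rewrite -big_split; apply: eq_bigr => i _; rewrite mxE mulrDl. Qed.

Lemma dotpZl a x u : dotp (a *: x) u = a * dotp x u.
Proof. by rewrite /dotp mulr_sumr; apply: eq_bigr => i _; rewrite mxE mulrA. Qed.

Lemma dotpNl x u : dotp (- x) u = - dotp x u.
Proof. by rewrite -scaleN1r dotpZl mulN1r. Qed.

Lemma dotpDr x y u : dotp u (x + y) = dotp u x + dotp u y.
Proof. by rewrite dotpC dotpDl !(dotpC u). Qed.

Lemma dotpZr a x u : dotp u (a *: x) = a * dotp u x.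
Proof. by rewrite dotpC dotpZl dotpC. Qed.

Lemma dotpNr x u : dotp u (- x) = - dotp u x.
Proof. by rewrite dotpC dotpNl dotpC. Qed.

Lemma dotp_delta x (j : 'I_n) : dotp (delta_mx 0 j) x = x 0 j.
Proof.
rewrite /dotp (bigD1 j)//= mxE !eqxx mul1r big1 ?addr0// => i /negPf ij.
by rewrite mxE ij andbF mul0r.
Qed.

Lemma dotp_ge0 x : 0 <= dotp x x.
Proof. by apply: sumr_ge0 => i _; rewrite -expr2 sqr_ge0. Qed.

Lemma dotp_eq0 x : dotp x x = 0 -> x = 0.
Proof.
move/eqP; rewrite psumr_eq0; last by move=> i _; rewrite -expr2 sqr_ge0.
move=> /allP h; apply/rowP => i; have := h i (mem_index_enum i).
by rewrite /= mxE -expr2 sqrf_eq0 => /eqP.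
Qed.

Lemma sphere_normalize v : 0 < dotp v v -> sphere ((Num.sqrt (dotp v v))^-1 *: v).
Proof.
move=> v0; rewrite /sphere/= dotpZl dotpZr mulrA -expr2 exprVn sqr_sqrtr ?ltW//.
by rewrite mulVf ?gt_eqF.
Qed.

Lemma sphereN x : sphere x -> sphere (- x).
Proof. by rewrite /sphere/= dotpNl dotpNr opprK. Qed.

Lemma sphere_dotp_itv x y : sphere x -> sphere y -> dotp x y \in `[-1, 1].
Proof.
rewrite /sphere/= => x1 y1.
have := dotp_ge0 (x - y); have := dotp_ge0 (x + y).
rewrite !(dotpDl, dotpDr, dotpNl, dotpNr) (dotpC y x) x1 y1 in_itv/=.
by move=> ? ?; apply/andP; split; lra.
Qed.

Lemma sphere_dotp1 x y : sphere x -> sphere y -> dotp x y = 1 -> x = y.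
Proof.
rewrite /sphere/= => x1 y1 xy; apply/eqP; rewrite -subr_eq0; apply/eqP/dotp_eq0.
by rewrite !(dotpDl, dotpDr, dotpNl, dotpNr) (dotpC y x) x1 y1 xy; ring.
Qed.

Lemma sphere_orthogonal x : (2 <= n)%N -> sphere x ->
  exists2 y, sphere y & dotp x y = 0.
Proof.
move=> n2 x1.
have [k xk] : exists k, x 0 k != 0.
  apply/existsP; apply: contra_eqT x1 => /existsPn x0.
  rewrite /dotp big1 => [|i _]; first by rewrite eq_sym oner_eq0.
  by have /negPn/eqP-> := x0 i; rewrite mul0r.
have [l lk] : exists l : 'I_n, l != k.
  have [k0|k0] := eqVneq (val k) 0%N.
    by exists (Ordinal n2); rewrite -val_eqE/= k0.
  by exists (Ordinal (ltnW n2)); rewrite -val_eqE/= eq_sym.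
(* A rotation by a right angle of the projection of [x] to a coordinate plane. *)
pose y := x 0 l *: delta_mx 0 k - x 0 k *: delta_mx 0 l : 'rV[R]_n.
have y0 : 0 < dotp y y.
  rewrite !(dotpDl, dotpDr, dotpNl, dotpNr, dotpZl, dotpZr) !dotp_delta !mxE !eqxx.
  rewrite (negPf lk) eq_sym (negPf lk) /=.
  have : 0 < x 0 k ^+ 2 by rewrite exprn_even_gt0.
  have := sqr_ge0 (x 0 l); nra.
exists ((Num.sqrt (dotp y y))^-1 *: y); first exact: sphere_normalize.
rewrite dotpZr (_ : dotp x y = 0) ?mulr0//.
by rewrite dotpC dotpDl dotpNl !dotpZl !dotp_delta; ring.
Qed.

Lemma sphere_dotp_onto y (t : R) : (2 <= n)%N -> sphere y -> t \in `[-1, 1] ->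
  exists2 x, sphere x & dotp x y = t.
Proof.
move=> n2 y1; rewrite in_itv/= => /andP[t0 t1].
have [z z1 yz] := sphere_orthogonal n2 y1.
exists (t *: y + Num.sqrt (1 - t ^+ 2) *: z).
  rewrite /sphere/= !(dotpDl, dotpDr, dotpZl, dotpZr) (dotpC z) yz y1 z1.
  have : Num.sqrt (1 - t ^+ 2) ^+ 2 = 1 - t ^+ 2 by rewrite sqr_sqrtr//; nra.
  nra.
by rewrite dotpDl !dotpZl (dotpC z) yz y1 mulr0 addr0 mulr1.
Qed.

End Sphere.

Lemma sphere_nonempty (R : realType) (n : nat) :
  exists x : 'rV[R]_n.+1, sphere x.
Proof. by exists (delta_mx 0 0); rewrite /sphere/= dotp_delta mxE eqxx. Qed.

(** * Designs integrate polynomials exactly *)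

Section Design.
Context {R : realType}.

Lemma poly_itv_eq0 (p : {poly R}) : (forall t, t \in `[-1, 1] -> p.[t] = 0) -> p = 0.
Proof.
move=> p0; apply/eqP; apply: contraT => pn0.
pose s : seq R := [seq i.+1%:R^-1 | i <- iota 0 (size p)].
have /max_poly_roots : all (root p) s.
  apply/allP => _ /mapP[i _ ->]; apply/eqP/p0; rewrite in_itv/=; apply/andP; split.
    by rewrite (le_trans (y := 0))// ?oppr_le0 ?ler01 ?invr_ge0.
  by rewrite invf_le1 ?ler1n.
move=> /(_ pn0); rewrite size_map size_iota ltnn; apply.
rewrite map_inj_uniq ?iota_uniq// => i j /invr_inj/eqP.
by rewrite eqr_nat eqSS => /eqP.
Qed.

Lemma derivn2_expS_horner (p : {poly R}) m y :
  (((p ^+ m.+1)^`(2))%R).[y] = m.+1%:R *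
    (m%:R * p.[y] ^+ m.-1 * (p^`()%R).[y] ^+ 2 + p.[y] ^+ m * (p^`(2)%R).[y]).
Proof.
rewrite !derivSn !derivn0 !deriv_exp derivMn derivM deriv_exp /=.
rewrite !(hornerD, hornerMn, hornerM, horner_exp).
ring.
Qed.

Variables (n' N K : nat).
Let n := n'.+2.
Variables (X : 'I_N -> 'rV[R]_n) (w : 'I_N -> R).
Hypothesis Xw : weighted_code X w.
Hypothesis desX : design K X w.

Lemma design_even_homogeneous l c : (0 < l)%N ->
  (forall x, sphere x -> \sum_(i < N) w i * dotp x (X i) ^+ l.*2 = c) ->
  forall v, \sum_(i < N) w i * dotp v (X i) ^+ l.*2 = c * dotp v v ^+ l.
Proof.
move=> l0 hc v; have := dotp_ge0 v; rewrite le_eqVlt => /predU1P[/esym v0|v0].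
  rewrite v0 (dotp_eq0 v0) expr0n eqn0Ngt l0 mulr0 big1// => i _.
  by rewrite -(scale0r 0) dotpZl mul0r expr0n double_eq0 eqn0Ngt l0 mulr0.
rewrite -(hc _ (sphere_normalize v0)) mulr_suml; apply: eq_bigr => i _.
set r := Num.sqrt _; have rE : dotp v v = r ^+ 2 by rewrite sqr_sqrtr// ltW.
have r0 : r != 0 by rewrite gt_eqF// sqrtr_gt0.
rewrite dotpZl exprMn exprVn rE -exprM mul2n; field.
by rewrite expf_neq0.
Qed.

(** Compare the Laplacians at [x] of the two sides of
    [sum_i w_i (v . x_i)^(2l+2) = c |v|^(2l+2)]. For each coordinate [j] both
    sides are polynomials in the displacement [s] of [x] along that axis, and
    [E] equates their second derivatives at 0. Summing over [j] uses
    [|x_i| = |x| = 1]. *)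
Lemma design_moment_rec l (c d : R) :
  (forall x, sphere x -> \sum_(i < N) w i * dotp x (X i) ^+ l.+1.*2 = c) ->
  (forall x, sphere x -> \sum_(i < N) w i * dotp x (X i) ^+ l.*2 = d) ->
  (l.*2.+1)%:R * d = (l.*2 + n)%:R * c.
Proof.
move=> hc hd; have [_ X1 _ _] := Xw.
have [x x1] := sphere_nonempty R n'.+1.
pose a i := dotp x (X i).
have E j : \sum_(i < N) w i *
      ((l.*2.+2)%:R * ((l.*2.+1)%:R * a i ^+ l.*2 * X i 0 j ^+ 2)) =
    c * (l.+1%:R * (l%:R * (2 * x 0 j) ^+ 2 + 2)).
  pose P : {poly R} := \sum_(i < N) w i *: (((a i)%:P + X i 0 j *: 'X) ^+ l.*2.+2).
  pose Q : {poly R} := c *: ((1 + (2 * x 0 j) *: 'X + 'X ^+ 2) ^+ l.+1).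
  have PQ : P = Q.
    apply/eqP; rewrite -subr_eq0; apply/eqP/poly_itv_eq0 => s _.
    have := design_even_homogeneous (ltn0Sn l) hc (x + s *: delta_mx 0 j).
    rewrite hornerD hornerN /P /Q horner_sum hornerZ !horner_exp !hornerE => H.
    apply/eqP; rewrite subr_eq0; apply/eqP.
    transitivity (c * dotp (x + s *: delta_mx 0 j) (x + s *: delta_mx 0 j) ^+ l.+1).
      rewrite -H; apply: eq_bigr => i _.
      rewrite hornerZ horner_exp hornerD hornerC hornerZ hornerX.
      by rewrite dotpDl dotpZl dotp_delta doubleS [X in a i + X]mulrC.
    congr (_ * _ ^+ _).
    rewrite !(dotpDl, dotpDr, dotpZl, dotpZr) (dotpC x) !dotp_delta mxE !eqxx x1/=; ring.
  have := congr1 (fun p : {poly R} => (p^`(2)%R).[0]) PQ.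
  have d0 : ((0 : {poly R})^`(2))%R = 0 by rewrite derivn_poly0 ?size_poly0.
  rewrite /P /Q (big_morph (derivn 2) (@derivnD R 2) d0) horner_sum derivnZ hornerZ.
  rewrite derivn2_expS_horner.
  have lin (u v : R) : let p := u%:P + v *: 'X in
      [/\ p.[0] = u, (p^`()%R).[0] = v & (p^`(2)%R).[0] = 0].
    move=> p; rewrite derivnS derivn1 /p !poly.derivE !hornerE; split=> //.
  have quad (v : R) : let p := 1 + v *: 'X + 'X ^+ 2 in
      [/\ p.[0] = 1, (p^`()%R).[0] = v & (p^`(2)%R).[0] = 2].
    move=> p; rewrite derivnS derivn1 /p !poly.derivE !hornerE/=; split=> //; ring.
  have [-> -> ->] := quad (2 * x 0 j).
  rewrite !expr1n mulr1 mul1r => <-; apply: eq_bigr => i _.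
  rewrite derivnZ hornerZ derivn2_expS_horner.
  by have [-> -> ->] := lin (a i) (X i 0 j); rewrite mulr0 addr0.
have n1 : 2 * l.+1%:R != 0 :> R by rewrite mulf_neq0 ?pnatr_eq0.
apply: (mulfI n1).
have := eq_bigr _ (fun j _ => E j) : \sum_j _ = \sum_j _.
rewrite exchange_big/= => S.
transitivity (\sum_(i < N) \sum_(j < n) w i *
    (l.*2.+2%:R * (l.*2.+1%:R * a i ^+ l.*2 * X i 0 j ^+ 2))).
  rewrite -(hd x x1) !mulr_sumr; apply: eq_bigr => i _.
  rewrite -!mulr_sumr (_ : \sum_j _ = 1); last first.
    by rewrite -[RHS](X1 i); apply: eq_bigr => j _; rewrite expr2.
  rewrite /a (_ : (l.*2.+2)%:R = 2 * l.+1%:R); first by ring.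
  by rewrite -doubleS -mul2n natrM.
rewrite S -mulr_sumr -mulr_sumr big_split/= -mulr_sumr sumr_const card_ord.
rewrite (_ : \sum_j _ = 4); last first.
  transitivity (4 * dotp x x); last by rewrite x1 mulr1.
  by rewrite mulr_sumr; apply: eq_bigr => j _; ring.
rewrite natrD -mul2n natrM -mulr_natl; ring.
Qed.

(** Odd averages vanish by the symmetry of the sphere under [x |-> -x]. *)
Lemma design_moment k : (k <= K)%N -> forall x, sphere x ->
  \sum_(i < N) w i * dotp x (X i) ^+ k = moment n k / moment n 0.
Proof.
have [_ X1 _ w1] := Xw; have M0 := @moment0_gt0 R n'.
have [e e1] := sphere_nonempty R n'.+1.
elim/ltn_ind: k => k IHk kK.
have [c hc] : exists c, forall x, sphere x -> \sum_(i < N) w i * dotp x (X i) ^+ k = c.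
  have [|c hc] := (@desX 'X^k); first by rewrite size_polyXn.
  by exists c => x x1; rewrite -(hc x x1); apply: eq_bigr => i _; rewrite hornerXn.
have odd0 j b : odd j ->
    (forall x, sphere x -> \sum_(i < N) w i * dotp x (X i) ^+ j = b) -> b = 0.
  move=> oj hb; have := hb _ (sphereN e1); rewrite -[in X in _ = X -> _](hb _ e1).
  under eq_bigr => i _ do rewrite dotpNl exprNn -signr_odd oj expr1 mulN1r mulrN.
  rewrite sumrN (hb _ e1); lra.
case: k IHk kK hc => [|[|k]] IHk kK hc x x1.
- rewrite divff ?gt_eqF//.
  by under eq_bigr => i _ do rewrite mulr1.
- have := @moment_rec R n' 0; rewrite mulr0n mul0r => /esym/eqP.
  rewrite mulf_eq0 pnatr_eq0/= => /eqP->; rewrite mul0r hc//.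
  exact: odd0 hc.
have := @moment_rec R n' k.+1; rewrite /= => Mrec.
have n0 : (k.+1 + n'.+1)%:R != 0 :> R by rewrite pnatr_eq0.
have hk := IHk k (leqnSn k.+1) (ltnW (ltnW kK)).
rewrite hc//; apply: (mulfI n0); rewrite mulrA -Mrec -mulrA.
have [ok|ek] := boolP (odd k).
  by rewrite -(hk x x1) (odd0 k.+2 c)/= ?negbK// (hk x x1) (odd0 k _ ok hk) !mulr0.
have kE : k = (k./2).*2 by rewrite -[LHS]odd_double_half (negPf ek).
have := @design_moment_rec k./2 c (moment n k / moment n 0); rewrite doubleS -kE.
by rewrite addSnnS => /(_ hc hk) <-.
Qed.

Lemma Rintegral_horner_wn (p : {poly R}) :
  \int[lebesgue_measure]_(t in `[-1, 1]) (p.[t] * wn n t) =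
  \sum_(i < size p) p`_i * (moment n i / moment n 0).
Proof.
have gE : gamma n = (moment n 0)^-1 :> R.
  by congr (_^-1); apply: eq_Rintegral => t _; rewrite expr0 mul1r.
pose F d (t : R) := \sum_(i < d) p`_i / moment n 0 * (t ^+ i * wn_raw n t).
have intF d : (@lebesgue_measure R).-integrable `[-1, 1] (EFin \o F d).
  have -> : EFin \o F d = (fun t => \sum_(i <- enum 'I_d)
      (p`_i / moment n 0)%:E * (t ^+ i * wn_raw n t)%:E)%E.
    by apply/funext => t; rewrite /= /F sumEFin big_enum.
  by apply: integrable_sum => // i _; apply: integrableZl => //; exact: integrable_moment.
transitivity (\int[lebesgue_measure]_(t in `[-1, 1]) F (size p) t).
  apply: eq_Rintegral => t _; rewrite horner_coef mulr_suml; apply: eq_bigr => i _.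
  rewrite /wn gE; ring.
elim: (size p) => [|d IHd].
  by rewrite big_ord0 /F; under eq_Rintegral do rewrite big_ord0; rewrite Rintegral_cst// mul0r.
rewrite big_ord_recr/= -IHd mulrA mulrAC.
rewrite [moment n d]/moment -RintegralZl//; last exact: integrable_moment.
rewrite -RintegralD//; last first.
  exact: (integrableZl (mu := lebesgue_measure) _ _ (integrable_moment _ _)).
by apply: eq_Rintegral => t _; rewrite /F big_ord_recr.
Qed.

Lemma design_integral (p : {poly R}) x : (size p <= K.+1)%N -> sphere x ->
  \sum_(i < N) w i * p.[dotp x (X i)] =
  \int[lebesgue_measure]_(t in `[-1, 1]) (p.[t] * wn n t).
Proof.
move=> pK x1; rewrite Rintegral_horner_wn.
under eq_bigr => i _ do rewrite horner_coef mulr_sumr.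
rewrite exchange_big/=; apply: eq_bigr => k _.
rewrite -(@design_moment k _ x x1); last by rewrite -ltnS (leq_trans (ltn_ord k)).
by rewrite mulr_sumr; apply: eq_bigr => i _; rewrite mulrCA.
Qed.

(** If the average were zero it would be zero for every [x] on the sphere, so
    [p] would vanish at all dot products [x . x_i], and for a fixed [i] these
    fill [-1, 1]. *)
Lemma design_gt0 (p : {poly R}) x : (size p <= K.+1)%N -> p != 0 ->
  (forall t, t \in `[-1, 1] -> 0 <= p.[t]) -> sphere x ->
  0 < \sum_(i < N) w i * p.[dotp x (X i)].
Proof.
move=> pK pn0 p0 x1; have [_ X1 w0 w1] := Xw.
have ge0 y : sphere y -> forall i, 0 <= w i * p.[dotp y (X i)].
  by move=> y1 i; rewrite mulr_ge0 ?p0 ?sphere_dotp_itv ?(ltW (w0 i)).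
rewrite lt_neqAle sumr_ge0 ?andbT; last by move=> i _; exact: ge0.
apply: contra pn0 => /eqP S0; apply/eqP/poly_itv_eq0 => t tI.
have [i0 _] : exists i0 : 'I_N, True.
  apply: contrapT => nex; have /eqP := w1.
  rewrite big1 => [|i]; first by rewrite eq_sym oner_eq0.
  by case: nex; exists i.
have [y y1 <-] := @sphere_dotp_onto _ _ (X i0) t isT (X1 i0) tI.
have /eqP : \sum_(i < N) w i * p.[dotp y (X i)] = 0.
  by rewrite design_integral// -(@design_integral p x)// -S0.
rewrite psumr_eq0; last by move=> i _; exact: ge0.
move=> /allP/(_ i0 (mem_index_enum i0)) /=.
by rewrite mulf_eq0 gt_eqF//= => /eqP.
Qed.

End Design.

(** * Nodes and weights of the quadrature *)

Section Nodes.
Context {R : realType}.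
Variables (nu : bool) (n' m N : nat).
Let n := n'.+2.
Variables (X : 'I_N -> 'rV[R]_n) (w : 'I_N -> R).
Hypothesis Xw : weighted_code X w.
Hypothesis desX : design (2 * m + nu) X w.
Variables (lambda tau : nat -> R).
Hypothesis Q : quadrature n true nu m lambda tau.

Definition interior_nodes : seq R := [seq lambda j | j <- index_iota 1 m.+1].

(** The endpoints are listed as numbers, so that signs can be read off; they are
    the extreme values of [lambda] by [lambda_last] and [lambda_first]. *)
Definition nodes : seq R := 1 :: nseq nu (-1) ++ interior_nodes.

Lemma quadrature_design (p : {poly R}) (x : 'rV[R]_n) :
  (size p <= (2 * m + nu).+1)%N -> sphere x ->
  \sum_(i < N) w i * p.[dotp x (X i)] =
  \sum_(1 - nu <= j < m.+2) tau j * p.[lambda j].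
Proof.
move=> sp x1; have [_ _ Qp] := Q.
rewrite (design_integral Xw desX)// Qp; first by rewrite addn1.
by rewrite addn1 addSn.
Qed.

Lemma lambda_lt i j : (1 - nu <= i)%N -> (i < j)%N -> (j <= m.+1)%N -> lambda i < lambda j.
Proof. by have [+ _ _] := Q; rewrite addn1; apply. Qed.

Lemma lambda_inj i j : (1 - nu <= i <= m.+1)%N -> (1 - nu <= j <= m.+1)%N ->
  lambda i = lambda j -> i = j.
Proof.
move=> /andP[i0 i1] /andP[j0 j1] ij; case: (ltngtP i j) => // lij.
  by have := lambda_lt i0 lij j1; rewrite ij ltxx.
by have := lambda_lt j0 lij i1; rewrite ij ltxx.
Qed.

Let all_nodes := [seq lambda j | j <- index_iota (1 - nu) m.+2].

Let uniq_all_nodes : uniq all_nodes.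
Proof.
rewrite map_inj_in_uniq ?iota_uniq// => i j.
rewrite !mem_index_iota !ltnS; exact: lambda_inj.
Qed.

Let mem_all_nodes t :
  reflect (exists2 j, (1 - nu <= j <= m.+1)%N & lambda j = t) (t \in all_nodes).
Proof.
apply: (iffP mapP) => -[j].
  by rewrite mem_index_iota ltnS => jI ->; exists j.
by move=> jI <-; exists j => //; rewrite mem_index_iota ltnS.
Qed.

Let end_mem : 1 \in all_nodes /\ (nu -> -1 \in all_nodes).
Proof.
have [_ [P _ PQ] _] := Q; rewrite addn1 in PQ.
split; first by apply/mem_all_nodes/PQ; rewrite subrr mulr0 mul0r.
by move=> nuT; apply/mem_all_nodes/PQ; rewrite nuT subrr mulr0.
Qed.

Lemma nodes_nonneg_eq0 (q : {poly R}) :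
  (forall j, (1 - nu <= j <= m.+1)%N -> q.[lambda j] = 0) ->
  (size q <= (2 * m + nu).+1)%N ->
  (forall t, t \in `[-1, 1] -> 0 <= q.[t]) -> q = 0.
Proof.
move=> q0 sq qge0; apply/eqP; apply: contraT => qn0.
have [x x1] := sphere_nonempty R n'.+1.
have := design_gt0 Xw desX sq qn0 qge0 x1.
by rewrite quadrature_design// big_nat big1 ?ltxx// => j /q0->; rewrite mulr0.
Qed.

Let others := [seq t <- all_nodes | t \notin 1 :: nseq nu (-1)].

Let all_nodes_perm : perm_eq all_nodes (1 :: nseq nu (-1) ++ others).
Proof.
apply: uniq_perm => //.
- rewrite -cat_cons cat_uniq filter_uniq// andbT; apply/andP; split.
    by case: (nu) => //=; rewrite inE andbT; apply/eqP; lra.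
  by apply/hasPn => t; rewrite mem_filter => /andP[].
- move=> t; rewrite -cat_cons mem_cat mem_filter.
  have [|] := boolP (t \in 1 :: _) => //= tE.
  have [h1 h2] := end_mem.
  move: tE; rewrite inE => /predU1P[->//|]; rewrite mem_nseq => /andP[+ /eqP->].
  by rewrite lt0b => /h2.
Qed.

Let size_others : size others = m.
Proof.
have := perm_size all_nodes_perm; rewrite size_map size_iota /= size_cat size_nseq.
lia.
Qed.

(** The classical argument for the location of zeros of orthogonal polynomials.
    If some [r] were outside (-1, 1), then the product of [t - r], the end
    factors and the squares of the other factors would have constant sign, yet
    it vanishes at all nodes. Its degree [2m + nu] is just within reach. *)
Lemma others_itv : {in others, forall r, r \in `]-1, 1[}.
Proof.
move=> r ro; apply: contraT => rI.
have uo : uniq others by rewrite filter_uniq.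
pose q := root_poly (rem r others).
pose p := root_poly all_nodes * q.
have pE t : p.[t] = (t - 1) * (t + 1) ^+ nu * (t - r) * q.[t] ^+ 2.
  rewrite /p hornerM (perm_root_poly all_nodes_perm) root_poly_cons root_poly_cat.
  rewrite (perm_root_poly (perm_to_rem ro)) root_poly_cons.
  by case: (nu); rewrite /= ?root_poly_cons ?root_poly_nil ?opprK; ring.
have sp : (size p <= (2 * m + nu).+1)%N.
  rewrite size_root_polyM (perm_size all_nodes_perm) /= size_cat size_nseq size_others.
  rewrite size_rem// size_others; case: (m) size_others => [/size0nil oE|m' _].
    by rewrite oE in ro.
  by lia.
have pn0 : p != 0 by rewrite mulf_neq0 ?root_poly_neq0.
have p0 j : (1 - nu <= j <= m.+1)%N -> p.[lambda j] = 0.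
  by move=> jI; rewrite hornerM root_poly_mem ?mul0r//; apply/mem_all_nodes; exists j.
have aux t : t \in `[-1, 1] -> (t - 1 <= 0) && (0 <= (t + 1) ^+ nu * q.[t] ^+ 2).
  rewrite in_itv/= => /andP[t0 t1]; rewrite subr_le0 t1 mulr_ge0 ?sqr_ge0//.
  by rewrite exprn_ge0//; lra.
move: rI; rewrite in_itv/= negb_and -!leNgt => /orP[r1|r1].
  suff /eqP : - p = 0 by rewrite oppr_eq0 (negPf pn0).
  apply: nodes_nonneg_eq0; first by move=> j /p0; rewrite hornerN => ->; rewrite oppr0.
    by rewrite size_polyN.
  move=> t tI; have /andP[t1 h] := aux t tI; move: tI; rewrite in_itv/= => /andP[t0 _].
  rewrite hornerN pE; have : 0 <= (1 - t) * (t - r) by apply: mulr_ge0; lra.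
  nra.
suff /eqP : p = 0 by rewrite (negPf pn0).
apply: nodes_nonneg_eq0 => //.
move=> t tI; have /andP[t1 h] := aux t tI; move: tI; rewrite in_itv/= => /andP[t0 _].
rewrite pE; have : 0 <= (1 - t) * (r - t) by apply: mulr_ge0; lra.
nra.
Qed.

Let node_le1 j : (1 - nu <= j <= m.+1)%N ->
  [/\ -1 <= lambda j, lambda j <= 1 & nu || (-1 < lambda j)].
Proof.
move=> jI; have : lambda j \in all_nodes by apply/mem_all_nodes; exists j.
rewrite (perm_mem all_nodes_perm) inE mem_cat mem_nseq => /predU1P[->|/orP[/andP[+ /eqP->]|]].
- by split; rewrite ?orbT//; try lra; apply/orP; right; lra.
- by rewrite lt0b => ->; split=> //; lra.
- by move=> /others_itv; rewrite in_itv/= => /andP[a b]; split; rewrite ?a ?orbT ?ltW.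
Qed.

Lemma lambda_last : lambda m.+1 = 1.
Proof.
have [/mem_all_nodes[j /andP[j0 j1] jE] _] := end_mem.
move: j1; rewrite leq_eqVlt => /predU1P[<-//|jm].
have := lambda_lt j0 jm (leqnn _); rewrite jE.
have [|_ + _] := @node_le1 m.+1; first by rewrite leqnn andbT; lia.
lra.
Qed.

Lemma lambda_first : nu -> lambda 0 = -1.
Proof.
move=> nuT; have [_ /(_ nuT)/mem_all_nodes[j /andP[j0 j1] jE]] := end_mem.
case: j j0 j1 jE => // j j0 j1 jE.
have := @lambda_lt 0 j.+1 _ isT j1; rewrite jE nuT => /(_ isT).
have [|+ _ _] := @node_le1 0; first by rewrite nuT.
lra.
Qed.

Lemma interior_nodes_itv : {in interior_nodes, forall t, t \in `]-1, 1[}.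
Proof.
move=> _ /mapP[j + ->]; rewrite mem_index_iota ltnS => /andP[j0 j1].
have l1 : lambda j < 1 by rewrite -lambda_last; apply: lambda_lt => //; lia.
have [|_ _ /orP[nuT|l0]] := @node_le1 j; first by apply/andP; lia.
  rewrite in_itv/= l1 andbT -(lambda_first nuT); apply: lambda_lt => //; rewrite ?nuT//; lia.
by rewrite in_itv/= l0.
Qed.

Lemma mem_nodes t :
  reflect (exists2 j, (1 - nu <= j <= m.+1)%N & lambda j = t) (t \in nodes).
Proof.
apply: (iffP idP).
  rewrite inE mem_cat mem_nseq lt0b => /predU1P[->|/orP[/andP[nuT /eqP->]|/mapP[j + ->]]].
  - by exists m.+1; [lia|exact: lambda_last].
  - by exists 0%N; [rewrite nuT|exact: lambda_first].
  - by rewrite mem_index_iota => jI; exists j => //; lia.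
move=> [j jI <-]; rewrite inE mem_cat mem_nseq lt0b.
have [->|jm] := eqVneq j m.+1; first by rewrite lambda_last eqxx.
have [j0|j0] := eqVneq j 0%N.
  have nuT : nu by move: jI; rewrite j0; case: (nu).
  by rewrite j0 lambda_first// nuT eqxx orbT.
apply/orP; right; apply/orP; right; apply/mapP; exists j => //.
by rewrite mem_index_iota; lia.
Qed.

Lemma uniq_interior_nodes : uniq interior_nodes.
Proof.
rewrite map_inj_in_uniq ?iota_uniq// => i j; rewrite !mem_index_iota => iI jI.
by apply: lambda_inj; lia.
Qed.

Lemma size_interior_nodes : size interior_nodes = m.
Proof. by rewrite size_map size_iota subn1. Qed.

Lemma size_nodes : size nodes = (m + 1 + nu)%N.
Proof. by rewrite /= size_cat size_nseq size_interior_nodes; lia. Qed.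

Lemma uniq_nodes : uniq nodes.
Proof.
rewrite /nodes cons_uniq cat_uniq uniq_interior_nodes andbT mem_cat mem_nseq.
rewrite negb_or; apply/and3P; split.
- apply/andP; split; first by rewrite negb_and; apply/orP; right; apply/eqP; lra.
  by apply/negP => /interior_nodes_itv; rewrite in_itv/= ltxx andbF.
- by case: (nu).
- apply/hasPn => t /interior_nodes_itv; rewrite in_itv/= mem_nseq => /andP[t0 _].
  by rewrite negb_and gt_eqF ?orbT.
Qed.

Lemma nodes_itv : {in nodes, forall t, t \in `[-1, 1]}.
Proof.
move=> _ /mem_nodes[j /node_le1[l0 l1 _] <-].
by rewrite in_itv/= l0 l1.
Qed.

Lemma sub_interior_nodes : {subset interior_nodes <= nodes}.
Proof. by move=> t tz; rewrite inE mem_cat tz !orbT. Qed.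

Lemma quadrature_single k (p : {poly R}) (x : 'rV[R]_n) :
  (1 - nu <= k <= m.+1)%N -> sphere x -> (size p <= (2 * m + nu).+1)%N ->
  (forall t, t \in nodes -> t != lambda k -> p.[t] = 0) ->
  \sum_(i < N) w i * p.[dotp x (X i)] = tau k * p.[lambda k].
Proof.
move=> kI x1 sp p0; rewrite quadrature_design//.
rewrite (bigD1_seq k) ?iota_uniq ?mem_index_iota ?ltnS//=.
rewrite big_seq_cond big1 ?addr0// => j; rewrite mem_index_iota ltnS => /andP[jI jk].
rewrite p0 ?mulr0//; first by apply/mem_nodes; exists j.
by apply: contra_neq jk; exact: lambda_inj.
Qed.

(** Test the quadrature on a polynomial that vanishes at all other nodes, to
    second order at those inside (-1, 1). Only the factor [t - 1] is negative on
    [-1, 1], hence the sign in [p]. *)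
Lemma tau_gt0 k : (1 - nu <= k <= m.+1)%N -> 0 < tau k.
Proof.
move=> kI; set r := lambda k.
have rS : r \in nodes by apply/mem_nodes; exists k.
pose q := root_poly [seq t <- nodes | t != r] *
          root_poly [seq t <- interior_nodes | t != r].
pose p := (-1) ^+ (r != 1) *: q.
have [x x1] := sphere_nonempty R n'.+1.
have sp : (size p <= (2 * m + nu).+1)%N.
  rewrite (leq_trans (size_scale_leq _ _))// size_root_polyM ltnS.
  have -> : (2 * m + nu = (size nodes).-1 + size interior_nodes)%N.
    by rewrite size_nodes size_interior_nodes; lia.
  rewrite leq_add// size_filter ?count_size//.
  have := count_predC (pred1 r) nodes; rewrite (count_uniq_mem _ uniq_nodes) rS => <-.
  exact: leqnn.
have qr : q.[r] != 0.
  by rewrite hornerM mulf_neq0// root_poly_eq0 mem_filter eqxx.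
have p0 : p != 0.
  rewrite scaler_eq0 signr_eq0/=; apply: contraNneq qr => ->.
  by rewrite horner0.
have pge0 t : t \in `[-1, 1] -> 0 <= p.[t].
  rewrite in_itv/= => /andP[t0 t1].
  rewrite /p /q hornerZ hornerM /nodes /= filter_cat.
  set u := root_poly [seq _ <- interior_nodes | _].
  set v := [seq _ <- nseq _ _ | _].
  have v0 : 0 <= (root_poly v).[t].
    rewrite /v; case: (nu) => /=; last by rewrite root_poly_nil.
    by case: ifP => _; rewrite ?root_poly_cons root_poly_nil// opprK mulr1; lra.
  rewrite eq_sym; case: ifP => _ /=; rewrite ?root_poly_cons root_poly_cat -/u.
    rewrite (_ : _ * _ = (1 - t) * ((root_poly v).[t] * u.[t] ^+ 2)); last first.
      by rewrite expr1; ring.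
    by apply: mulr_ge0; rewrite ?subr_ge0// mulr_ge0 ?sqr_ge0.
  by rewrite expr0 mul1r -mulrA mulr_ge0// -expr2 sqr_ge0.
have := design_gt0 Xw desX sp p0 pge0 x1.
rewrite (@quadrature_single k)//; last first.
  by move=> t tS tr; rewrite hornerZ hornerM root_poly_mem ?mul0r ?mulr0// mem_filter tr.
by move=> h; apply: contraLR h; rewrite -!leNgt => h; rewrite mulr_le0_ge0 ?pge0 ?nodes_itv.
Qed.

(** The polynomial [l] is, up to a factor, the Lagrange polynomial of the node
    [lambda k]. Its degree [m + nu] is at most [2m + nu]. *)
Lemma node_mass x : sphere x -> (forall i, dotp x (X i) \in nodes) ->
  forall k, (1 - nu <= k <= m.+1)%N ->
  \sum_(i < N | dotp x (X i) == lambda k) w i = tau k.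
Proof.
move=> x1 xS k kI; set r := lambda k.
have rS : r \in nodes by apply/mem_nodes; exists k.
pose l := root_poly (rem r nodes).
have l0 t : t \in nodes -> t != r -> l.[t] = 0.
  by move=> tS tr; rewrite root_poly_mem// mem_rem_uniq ?uniq_nodes// inE tr.
have lr : l.[r] != 0.
  by rewrite root_poly_eq0 mem_rem_uniq ?uniq_nodes// inE eqxx.
have sl : (size l <= (2 * m + nu).+1)%N.
  by rewrite size_root_poly size_rem// size_nodes; lia.
apply: (mulIf lr); rewrite -(quadrature_single kI x1 sl l0).
rewrite mulr_suml big_mkcond; apply: eq_bigr => i _.
by case: eqP => [->//|/eqP ir]; rewrite l0 ?mulr0.
Qed.

(** * The extremal bound and its equality case *)

Section Potential.
Variable f : R -> R.
Hypothesis af : admissible f.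
Hypothesis df : has_deriv (2 * m + 1 + nu) f.
Hypothesis f0 : forall t : R, t \in `]-1, 1[ -> 0 <= derive1n (2 * m + 1 + nu) f t.

Let within_f : {within `[-1, 1], continuous f}.
Proof.
have N11 : (-1 : R) < 1 by lra.
have [d l r] := af; apply/(continuous_within_itvP f N11); split => //.
by move=> t /d; rewrite derivable1_diffP => /differentiable_continuous.
Qed.

(** In the error formula the polynomial with simple roots at the endpoints and
    double roots at the other nodes is negative on [-1, 1] away from the nodes:
    [t - 1] is its only factor of negative sign. *)
Lemma hermite_majorant : exists L : {poly R},
  [/\ (size L <= (2 * m + nu).+1)%N, {in nodes, forall t, L.[t] = f t},
    forall t, t \in `[-1, 1] -> f t <= L.[t] &
    (forall t, t \in `]-1, 1[ -> 0 < derive1n (2 * m + 1 + nu) f t) ->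
    forall t, t \in `[-1, 1] -> f t = L.[t] -> t \in nodes].
Proof.
have [L [sL LS Lz]] := hermite_interpolation f (derive1 f)
  uniq_nodes uniq_interior_nodes sub_interior_nodes.
have szn : (size nodes + size interior_nodes)%N = (2 * m + nu).+1.
  by rewrite size_nodes size_interior_nodes; lia.
have KE : (2 * m + 1 + nu)%N = (2 * m + nu).+1 by lia.
move: df f0; rewrite KE => df' f0'.
rewrite szn in sL.
have err t : t \in `[-1, 1] -> t \notin nodes ->
    exists c, exists2 xi : R, xi \in `]-1, 1[ &
    0 < c /\ f t - L.[t] = - (derive1n (2 * m + nu).+1 f xi * c).
  move=> tI tS; have [xi xiI E] := hermite_error df' within_f uniq_nodes nodes_itv
    uniq_interior_nodes sub_interior_nodes interior_nodes_itv szn sL LS Lz tI tS.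
  exists (- (root_poly nodes * root_poly interior_nodes).[t] /
          ((2 * m + nu).+1)`!%:R), xi => //; split; last by rewrite E; ring.
  rewrite divr_gt0 ?ltr0n ?fact_gt0// hornerM /nodes root_poly_cons root_poly_cat.
  have : (root_poly interior_nodes).[t] != 0.
    by rewrite root_poly_eq0; apply: contra tS => /sub_interior_nodes.
  set u := (root_poly interior_nodes).[t] => u0.
  move: tI tS; rewrite in_itv/= inE mem_cat.
  move=> /andP[t0 t1] /norP[tn1 /norP[tm _]].
  have t1' : t < 1 by rewrite lt_neqAle tn1.
  have v0 : 0 < (root_poly (nseq nu (-1))).[t].
    move: tm; case: (nu) => /=; rewrite ?root_poly_cons root_poly_nil// inE => tm.
    by rewrite mulr1 opprK -[1]opprK subr_gt0 lt_neqAle eq_sym tm.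
  rewrite (_ : - _ = (1 - t) * (root_poly (nseq nu (-1))).[t] * u ^+ 2); last by ring.
  by apply: mulr_gt0; [rewrite mulr_gt0 ?subr_gt0|rewrite exprn_even_gt0].
exists L; split => //.
  move=> t tI; have [/LS->//|tS] := boolP (t \in nodes).
  have [c [xi xiI [c0 E]]] := err t tI tS.
  by rewrite -subr_le0 E oppr_le0 mulr_ge0 ?f0' ?ltW.
move=> fpos t tI ftL; apply: contraT => tS.
have [c [xi xiI [c0 E]]] := err t tI tS.
have := mulr_gt0 (fpos xi xiI) c0.
by rewrite -oppr_lt0 -E ftL subrr ltxx.
Qed.

Lemma majorant_quadrature (L : {poly R}) x :
  (size L <= (2 * m + nu).+1)%N -> {in nodes, forall t, L.[t] = f t} -> sphere x ->
  \sum_(i < N) w i * L.[dotp x (X i)] = \sum_(1 - nu <= j < m.+2) tau j * f (lambda j).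
Proof.
move=> sL LS x1; rewrite quadrature_design//; apply: eq_big_nat => j jI.
by rewrite LS//; apply/mem_nodes; exists j.
Qed.

Lemma potential_le x : sphere x ->
  potential f X w x <= \sum_(1 - nu <= j < m.+2) tau j * f (lambda j).
Proof.
move=> x1; have [L [sL LS fL _]] := hermite_majorant; have [_ X1 w0 _] := Xw.
rewrite -(@majorant_quadrature L x)//; apply: ler_sum => i _.
by rewrite ler_wpM2l ?(ltW (w0 i))// fL// sphere_dotp_itv.
Qed.

Lemma potential_eq_nodes x : sphere x -> (forall i, dotp x (X i) \in nodes) ->
  potential f X w x = \sum_(1 - nu <= j < m.+2) tau j * f (lambda j).
Proof.
move=> x1 xS; have [L [sL LS _ _]] := hermite_majorant.
by rewrite -(@majorant_quadrature L x)//; apply: eq_bigr => i _; rewrite LS.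
Qed.

Lemma potential_eq_dots x :
  (forall t, t \in `]-1, 1[ -> 0 < derive1n (2 * m + 1 + nu) f t) -> sphere x ->
  potential f X w x = \sum_(1 - nu <= j < m.+2) tau j * f (lambda j) ->
  forall i, dotp x (X i) \in nodes.
Proof.
move=> fpos x1 E; have [L [sL LS fL fLS]] := hermite_majorant; have [_ X1 w0 _] := Xw.
have xI i : dotp x (X i) \in `[-1, 1] by exact: sphere_dotp_itv.
have := majorant_quadrature sL LS x1; rewrite -E => /eqP.
rewrite -subr_eq0 -sumrB psumr_eq0; last first.
  by move=> i _; rewrite -mulrBr mulr_ge0 ?(ltW (w0 i))// subr_ge0 fL.
move=> /allP h i; apply: fLS => //.
have := h i (mem_index_enum i); rewrite /= -mulrBr mulf_eq0 gt_eqF//= subr_eq0.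
by move=> /eqP.
Qed.

End Potential.

Let mem_other_dots x t :
  reflect (exists2 i, X i != x & dotp x (X i) = t) (t \in other_dots X x).
Proof.
rewrite mem_undup; apply: (iffP mapP) => -[i].
  by rewrite mem_filter => /andP[ix _] ->; exists i.
by move=> ix <-; exists i => //; rewrite mem_filter ix mem_enum.
Qed.

(** The dot products of [x] form [m + nu + 1] points containing the endpoints
    among the nodes. If a node [r] inside (-1, 1) were not among them, let [p]
    vanish at all these dot products and at the other nodes inside (-1, 1). Then
    the average of [p] is zero but equals [tau k * p.[r]], which is not. So the dot products
    include all the nodes, and there are as many of each. *)
Lemma sharp_dots x : A1 nu X x -> size (other_dots X x) = (m + nu)%N ->
  sphere x /\ forall i, dotp x (X i) \in nodes.
Proof.
move=> Ax sD; have [_ X1 w0 _] := Xw; set D := other_dots X x in sD *.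
have uD : uniq D by exact: undup_uniq.
have xX : range X x by move: Ax; rewrite /A1; case: (nu) => // -[].
have x1 : sphere x by have [i _ <-] := xX; exact: X1.
have N1D : nu -> -1 \in D.
  move=> nuT; move: Ax; rewrite /A1 nuT => -[_ [_ [i _ <-] xE]].
  apply/mem_other_dots; exists i; last by rewrite -xE dotpNl (X1 i).
  rewrite -xE; apply: contra_eqN (X1 i) => /eqP iE.
  rewrite [X in dotp X _]iE dotpNl (X1 i); apply/eqP; lra.
have dotsD i : dotp x (X i) \in 1 :: D.
  rewrite inE; have [->|ix] := eqVneq (X i) x; first by rewrite x1 eqxx.
  by apply/orP; right; apply/mem_other_dots; exists i.
have zD : {subset interior_nodes <= D}.
  move=> _ /mapP[k + ->]; rewrite mem_index_iota => kI.
  have kI' : (1 - nu <= k <= m.+1)%N by lia.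
  set r := lambda k; apply: contraT => rD.
  have rz : r \in interior_nodes by apply/mapP; exists k => //; rewrite mem_index_iota.
  pose p := root_poly (1 :: D) * root_poly (rem r interior_nodes).
  have sp : (size p <= (2 * m + nu).+1)%N.
    rewrite size_root_polyM /= sD size_rem// size_interior_nodes; lia.
  have pr : p.[r] != 0.
    rewrite hornerM mulf_neq0// root_poly_eq0.
      rewrite inE (negPf rD) orbF; have := interior_nodes_itv rz.
      by rewrite in_itv/= => /andP[_ r1]; rewrite lt_eqF.
    by rewrite mem_rem_uniq ?uniq_interior_nodes// inE eqxx.
  have := quadrature_single kI' x1 sp.
  rewrite big1; last by move=> i _; rewrite hornerM root_poly_mem// mul0r mulr0.
  move=> E; have : tau k * p.[r] = 0.
    rewrite -E// => t; rewrite inE mem_cat mem_nseq lt0b => tS tr.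
    rewrite hornerM; case/predU1P: tS => [->|/orP[/andP[nuT /eqP->]|tz]].
    - by rewrite root_poly_mem ?mul0r// mem_head.
    - by rewrite root_poly_mem ?mul0r// inE N1D ?orbT.
    - rewrite [X in _ * X]root_poly_mem ?mulr0// mem_rem_uniq ?inE ?tr//.
      exact: uniq_interior_nodes.
  by move/eqP; rewrite mulf_eq0 (negPf pr) gt_eqF// tau_gt0.
split => // i; move: (dotsD i); rewrite !inE => /predU1P[->|iD]; first by rewrite eqxx.
apply/orP; right.
have [||| _ ->] := @uniq_min_size _ (nseq nu (-1) ++ interior_nodes) D => //.
- by move: uniq_nodes; rewrite cons_uniq => /andP[].
- move=> t; rewrite mem_cat mem_nseq lt0b => /orP[/andP[/N1D ? /eqP->]//|]; exact: zD.
- by rewrite sD size_cat size_nseq size_interior_nodes addnC.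
Qed.

(** Every node occurs as a dot product, since the mass at each node is
    positive. The nodes 1 and -1 occur only for the code points [x] and [- x]. *)
Lemma node_dots_structure x : sphere x -> (forall i, dotp x (X i) \in nodes) ->
  [/\ A1 nu X x, dots X x =i nodes & weakly_sharp m nu X w].
Proof.
move=> x1 xS; have [_ X1 w0 _] := Xw.
have hit k : (1 - nu <= k <= m.+1)%N -> exists i, dotp x (X i) = lambda k.
  move=> kI; apply: contrapT => nex; have := tau_gt0 kI.
  rewrite -(node_mass x1 xS kI) big1 ?ltxx// => i /eqP ik.
  by case: nex; exists i.
have memdots t : (t \in dots X x) = (t \in nodes).
  rewrite mem_undup; apply/mapP/mem_nodes => [[i _ ->]|[k kI <-]].
    exact/mem_nodes.
  by have [i <-] := hit k kI; exists i => //; rewrite mem_enum.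
have xX : range X x.
  have /mem_nodes[k kI kE] : 1 \in nodes by exact: mem_head.
  have [i] := hit k kI; rewrite kE => /(sphere_dotp1 x1 (X1 i)) ->.
  by exists i.
have N1 : nu -> exists i, X i = - x.
  move=> nuT; have /mem_nodes[k kI kE] : -1 \in nodes.
    by rewrite inE mem_cat mem_nseq nuT eqxx orbT.
  have [i] := hit k kI; rewrite kE => iE; exists i; apply/esym.
  by apply: sphere_dotp1 => //; [exact: sphereN|rewrite dotpNl iE opprK].
have odS : {subset other_dots X x <= nseq nu (-1) ++ interior_nodes}.
  move=> t /mem_other_dots[i ix tE]; have := xS i; rewrite inE tE => /predU1P[t1|//].
  by move: ix; rewrite -(sphere_dotp1 x1 (X1 i)) ?eqxx// tE.
have szo := uniq_leq_size (undup_uniq _) odS.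
rewrite size_cat size_nseq size_interior_nodes addnC in szo.
split => //.
- rewrite /A1; case: (nu) N1 => // /(_ isT)[i iE]; split => //.
  by exists (X i); [exists i|rewrite iE opprK].
- move: szo desX N1 => +++; rewrite /weakly_sharp; case: (nu) => /= szo dX N1.
    split => //; exists x => //; split => //.
    have [i iE] := N1 isT; apply/mem_other_dots; exists i.
      rewrite iE; apply/eqP => xE; have : dotp (- x) x = -1 by rewrite dotpNl x1.
      by rewrite xE x1; lra.
    by rewrite iE dotpNr x1.
  by split; rewrite ?addn0 in szo dX *; [|exists x].
Qed.

End Nodes.

Unset Implicit Arguments.

Theorem theorem5p3 (R : realType) (nu : bool) (n m N : nat)
    (hn : (2 <= n)%N) (hm : (1 <= m)%N) (hN : (1 <= N)%N)
    (f : R -> R) (hf : admissible f)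
    (hfd : has_deriv (2 * m + 1 + nu) f)
    (hf0 : forall t : R, t \in `]-1, 1[ -> 0 <= derive1n (2 * m + 1 + nu) f t)
    (X : 'I_N -> 'rV[R]_n) (w : 'I_N -> R) (hXw : weighted_code X w)
    (hdes : design (2 * m + nu) X w)
    (lambda tau : nat -> R) (hQ : quadrature n true nu m lambda tau) :
  [/\ forall x : 'rV[R]_n, sphere x ->
        potential f X w x <=
        \sum_(1 - nu <= j < m.+2) tau j * f (lambda j),
      weakly_sharp m nu X w ->
        forall x : 'rV[R]_n, A1 nu X x -> size (other_dots X x) = (m + nu)%N ->
          potential f X w x =
          \sum_(1 - nu <= j < m.+2) tau j * f (lambda j)
    & (forall t : R, t \in `]-1, 1[ -> 0 < derive1n (2 * m + 1 + nu) f t) ->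
        forall x : 'rV[R]_n, sphere x ->
          potential f X w x =
          \sum_(1 - nu <= j < m.+2) tau j * f (lambda j) ->
          [/\ [/\ A1 nu X x,
                  size (dots X x) = (m + 1 + nu)%N
                & forall t, t \in dots X x <->
                    exists2 j, (1 - nu <= j <= m + 1)%N & lambda j = t],
              weakly_sharp m nu X w
            & forall j, (1 - nu <= j <= m + 1)%N ->
                \sum_(i < N | dotp x (X i) == lambda j) w i = tau j]].
Proof.
case: n hn X hXw hdes hQ => [//|[//|n']] _ X hXw hdes hQ; split.
- move=> x x1; exact (potential_le hXw hdes hQ hf hfd hf0 x1).
- move=> _ x Ax sD.
  have [x1 xS] := sharp_dots hXw hdes hQ Ax sD.
  exact (potential_eq_nodes hXw hdes hQ hf hfd hf0 x1 xS).
- move=> fpos x x1 E.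
  have xS := potential_eq_dots hXw hdes hQ hf hfd hf0 fpos x1 E.
  have [Ax dS ws] := node_dots_structure hXw hdes hQ x1 xS.
  rewrite addn1; split => //; last exact (node_mass hXw hdes hQ x1 xS).
  split => //.
    rewrite -[m.+1]addn1 -(size_nodes hXw hdes hQ).
    apply/perm_size/uniq_perm; [exact: undup_uniq| |exact: dS].
    exact (uniq_nodes hXw hdes hQ).
  by move=> t; rewrite dS; split => /(mem_nodes hXw hdes hQ).
Qed.
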